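(* Let $\mathfrak{h}(x)=\dfrac{1}{\log(1/x)}$ and let $E\subseteq\mathbb{R}^2$ be an $F_{\mathfrak{h}}$-set. Then $\dim(E)\ge\frac12$, where $\dim$ denotes Hausdorff dimension.
   Context: Dimension functions: $\mathbb{H}$ is the set of functions $h:[0,\infty)\to[0,\infty)$ that are non-decreasing, right continuous, and satisfy $h(0)=0$. The formula for $\mathfrak{h}$ is understood for small $x>0$; $\mathfrak{h}$ denotes any element of $\mathbb{H}$ that equals $1/\log(1/x)$ for all sufficiently small $x>0$ (the measure $\mathcal{H}^{\mathfrak{h}}$ depends only on the values near $0$). Hausdorff measures: for $h\in\mathbb{H}$, $E\subseteq\mathbb{R}^2$ and $\delta>0$, $\mathcal{H}^h_\delta(E)=\inf\{\sum_i h(\operatorname{diam}(E_i)) : E\subseteq\bigcup_{i=1}^\infty E_i,\ \operatorname{diam}(E_i)<\delta\}$, and $\mathcal{H}^h(E)=\sup_{\delta>0}\mathcal{H}^h_\delta(E)$. Furstenberg sets: for $\mathfrak{h}\in\mathbb{H}$, a set $E\subseteq\mathbb{R}^2$ is an $F_{\mathfrak{h}}$-set if for each direction $e$ in the unit circle $\mathbb{S}$ there is a line segment $\ell_e$ in the direction of $e$ such that $\mathcal{H}^{\mathfrak{h}}(\ell_e\cap E)>0$. *)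

(* Defs.v *)
From mathcomp Require Import all_boot all_order all_algebra.
From mathcomp Require Import all_classical all_reals all_analysis.

Set Implicit Arguments.
Unset Strict Implicit.
Unset Printing Implicit Defensive.

Import Order.TTheory GRing.Theory Num.Theory.
Import numFieldNormedType.Exports.

Local Open Scope classical_set_scope.
Local Open Scope ring_scope.

(* The norm [`|v|] of the library on ['rV[R]_n] is the sup norm. *)
Definition eucl_norm (R : realType) (n : nat) (v : 'rV[R]_n) : R :=
  Num.sqrt (\sum_(i < n) v 0 i ^+ 2).

(* Extended-real valued, so that unbounded sets have diameter +oo; the
   inserted 0 gives the empty set diameter 0 instead of -oo. *)
Definition diam (R : realType) (n : nat) (E : set 'rV[R]_n) : \bar R :=
  ereal_sup (0%E |` [set (eucl_norm (x - y))%:E | x in E & y in E]).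

(* A function from [0, +oo) to [0, +oo) is represented by a function on R
   whose values at negative arguments are irrelevant. *)
Definition dimension_function (R : realType) (h : R -> R) : Prop :=
  [/\ forall x : R, 0 <= x -> 0 <= h x,
      forall x y : R, 0 <= x -> x <= y -> h x <= h y,
      forall x : R, 0 <= x -> h y @[y --> x^'+] --> h x
    & h 0 = 0].

(* [fine] is harmless here: the diameters of a cover are below [delta]. *)
Definition hausdorff_delta (R : realType) (n : nat) (h : R -> R) (delta : R)
    (E : set 'rV[R]_n) : \bar R :=
  ereal_inf [set (\sum_(0 <= i <oo) (h (fine (diam (F i))))%:E)%E
            | F in [set F : nat -> set 'rV[R]_n |
                     E `<=` \bigcup_i F i /\
                     forall i, (diam (F i) < delta%:E)%E]].

Definition hausdorff_measure (R : realType) (n : nat) (h : R -> R)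
    (E : set 'rV[R]_n) : \bar R :=
  ereal_sup [set hausdorff_delta h delta E | delta in [set d : R | 0 < d]].

(* Only s > 0 is used, so that x |-> x `^ s is a dimension function
   (0 `^ 0 = 1); the exponent 0 does not affect the infimum. *)
Definition hausdorff_dim (R : realType) (n : nat) (E : set 'rV[R]_n) : \bar R :=
  ereal_inf [set s%:E | s in [set s : R |
    0 < s /\ hausdorff_measure (fun x : R => x `^ s) E = 0%E]].

Definition unit_circle (R : realType) : set 'rV[R]_2 :=
  [set e | eucl_norm e = 1].

Definition segment (R : realType) (n : nat) (a e : 'rV[R]_n) (L : R) :
    set 'rV[R]_n :=
  [set a + t *: e | t in `[0, L]].

Definition furstenberg_set (R : realType) (h : R -> R) (E : set 'rV[R]_2) :
    Prop :=
  forall e : 'rV[R]_2, unit_circle e ->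
    exists (a : 'rV[R]_2) (L : R),
      0 < L /\ (0 < hausdorff_measure h (segment a e L `&` E))%E.

(* Main.v *)
Require Import Defs.
From mathcomp Require Import all_boot all_order all_algebra.
From mathcomp Require Import all_classical all_reals all_analysis.
From mathcomp Require Import ring lra.

Import Order.TTheory GRing.Theory Num.Theory.
Import numFieldNormedType.Exports.

Local Open Scope classical_set_scope.
Local Open Scope ring_scope.

(** Suppose that the [s]-dimensional measure of [E] is zero for some
    [s < 1/2].  Then [E] has covers [F i] with weights [w i > 0] of arbitrarily
    small sum such that [diam (F i) <= w i `^ s^-1].  Fix [1 < a < s^-1 / 2] and
    a large [K], and sort the indices into hyperdyadic classes: class [j]
    consists of the [i] with
    [expR (- K a^(j+1)) <= w i <= expR (- K a^j)].

    Let [S] be the part of [E] on a line.  If, for every [j], the points of [S]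
    lying in sets of class [j] were within [r j = expR (- eta K a^j)] of one
    another, then one set of diameter at most [r j] per class would cover [S],
    at the cost [\sum_j h (r j) = \sum_j (eta K a^j)^-1].  Since [h] is
    [1 / log (1/x)], this is a geometric series, and it is small when [K] is
    large.  So if [S] has Hausdorff [h]-content bounded below, two sets
    [F i], [F i'] of a common class contain points of [S] more than [r j] apart
    ([exists_separated_pair]).

    Two points of [F i] and [F i'] that far apart determine the slope of the
    line up to an error of order
    [expR (- s^-1 K a^j) / r j] ([slope_close]).  With [eta = s^-1 - 2 a],
    which is positive, this is [(expR (- K a^(j+1)))^2], hence at most
    [w i * w i'].  The slopes coming from the pair [(i, i')] thus have outer
    Lebesgue measure [O (w i * w i')], and all pairs together contribute
    [O ((\sum_i w i)^2)], which is arbitrarily small.  So the slopes of lines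
    with content above a fixed threshold form a null set
    ([lebesgue_outer_rich_slopes_eq0]).  For a Furstenberg set, countably many
    of these null sets would cover the slopes in [0, 1], which is absurd. *)

(** Outer measure, because nothing makes the sets of slopes measurable. *)
Local Notation lebesgue_outer := ((@wlength _ idfun)^*)%mu.

(** * Euclidean norm and diameter *)

Lemma ler_abs_eucl_norm (R : realType) (n : nat) (v : 'rV[R]_n) (i : 'I_n) :
  `|v 0 i| <= eucl_norm v.
Proof.
rewrite -sqrtr_sqr ler_sqrt ?sumr_ge0 //; last by move=> j _; exact: sqr_ge0.
by rewrite (bigD1 i) //= lerDl sumr_ge0 // => j _; exact: sqr_ge0.
Qed.

Lemma eucl_norm2E (R : realType) (v : 'rV[R]_2) :
  eucl_norm v = Num.sqrt (v 0 0 ^+ 2 + v 0 1 ^+ 2).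
Proof.
rewrite /eucl_norm !big_ord_recl big_ord0 addr0.
by congr (Num.sqrt (_ + v 0 _ ^+ 2)); exact: val_inj.
Qed.

Lemma eucl_norm2_le (R : realType) (v : 'rV[R]_2) :
  eucl_norm v <= `|v 0 0| + `|v 0 1|.
Proof.
rewrite eucl_norm2E -(ler_pXn2r (n := 2)) ?nnegrE ?sqrtr_ge0 ?addr_ge0 //.
rewrite sqr_sqrtr ?addr_ge0 ?sqr_ge0 // sqrrD !real_normK ?num_real //.
by rewrite lerD2r lerDl mulrn_wge0 // mulr_ge0.
Qed.

Lemma diam_ge0 (R : realType) (n : nat) (F : set 'rV[R]_n) : (0 <= diam F)%E.
Proof. by apply: ereal_sup_ubound; left. Qed.

Lemma eucl_norm_le_diam (R : realType) (n : nat) (F : set 'rV[R]_n)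
    (x y : 'rV[R]_n) :
  F x -> F y -> ((eucl_norm (x - y))%:E <= diam F)%E.
Proof.
by move=> Fx Fy; apply: ereal_sup_ubound; right; exists x => //; exists y.
Qed.

Lemma diam_le (R : realType) (n : nat) (F : set 'rV[R]_n) (r : R) :
  0 <= r -> (forall x y, F x -> F y -> eucl_norm (x - y) <= r) ->
  (diam F <= r%:E)%E.
Proof.
move=> r0 Fr.
apply: ge_ereal_sup => _ [->|[x Fx [y Fy <-]]]; rewrite lee_fin //.
exact: Fr.
Qed.

(** * Hausdorff content *)

Lemma hausdorff_delta_anti (R : realType) (n : nat) (h : R -> R) (d1 d2 : R)
    (S : set 'rV[R]_n) :
  d1 <= d2 -> (hausdorff_delta h d2 S <= hausdorff_delta h d1 S)%E.
Proof.
move=> d12; apply: ereal_inf_le_tmp => _ [F [SF dF] <-].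
exists F => //; split=> // i.
by rewrite (lt_le_trans (dF i)) // lee_fin.
Qed.

Lemma hausdorff_delta_le_cover (R : realType) (n : nat) (h : R -> R) (delta : R)
    (S : set 'rV[R]_n) (G : nat -> set 'rV[R]_n) (r : nat -> R) :
  dimension_function h -> S `<=` \bigcup_j G j ->
  (forall j, 0 <= r j < delta) ->
  (forall j x y, G j x -> G j y -> eucl_norm (x - y) <= r j) ->
  (hausdorff_delta h delta S <= \sum_(0 <= j <oo) (h (r j))%:E)%E.
Proof.
move=> [h0 hmono _ _] SG rd Gr.
have dG j : (diam (G j) <= (r j)%:E)%E.
  by apply: diam_le => [|x y]; [case/andP: (rd j) | exact: Gr].
have fdG j : 0 <= fine (diam (G j)) by rewrite fine_ge0 // diam_ge0.
apply: (@le_trans _ _ (\sum_(0 <= j <oo) (h (fine (diam (G j))))%:E)%E).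
  apply: ereal_inf_lbound; exists G => //; split=> // j.
  by rewrite (le_lt_trans (dG j)) // lte_fin; case/andP: (rd j).
apply: lee_nneseries => [j _ _|j _]; rewrite lee_fin; first exact: h0.
apply: hmono => //; rewrite -lee_fin fineK //.
by rewrite ge0_fin_numE ?diam_ge0 // (le_lt_trans (dG j)) ?ltry.
Qed.

(** * Series and scales *)

Lemma nneseries_geometric_le (R : realType) (c q : R) :
  0 <= c -> 0 < q < 1 ->
  (\sum_(0 <= j <oo) (c * q ^+ j)%:E <= (c / (1 - q))%:E)%E.
Proof.
move=> c0 /andP[q0 q1]; apply: lime_le.
  by apply: is_cvg_nneseries => j _ _; rewrite lee_fin mulr_ge0 ?exprn_ge0 // ltW.
apply: nearW => k; rewrite sumEFin lee_fin.
by apply: (geometric_le_lim k c0 q0); rewrite gtr0_norm.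
Qed.

Lemma exists_geometric_scale (R : realType) (a y : R) :
  1 < a -> 1 <= y -> exists j : nat, a ^+ j <= y < a ^+ j.+1.
Proof.
move=> a1 y1.
have ex : exists n : nat, y < a ^+ n.
  have c : (GRing.exp a^-1 : R^nat) @ \oo --> (0 : R).
    apply: cvg_expr; rewrite ger0_norm ?invr_ge0; last by lra.
    by rewrite invf_lt1; lra.
  have y0 : 0 < y^-1 by rewrite invr_gt0; lra.
  have /cvgr0_norm_lt/(_ _ y0)[n _ /(_ n (leqnn n))] := c.
  rewrite /= exprVn ger0_norm ?invr_ge0 ?exprn_ge0 //; last lra.
  by rewrite ltf_pV2 ?posrE ?exprn_gt0 //; [exists n | lra..].
have [[|j] yj jmin] := ex_minnP ex; first by rewrite expr0 in yj; lra.
by exists j; rewrite yj andbT leNgt; apply/negP => /jmin; rewrite ltnn.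
Qed.

(** * Slopes determined by separated points *)

(** Here [u] and [u'] are differences of points of two lines of slopes [t] and
    [t'].  From [(t - t') u'_0 = (u_1 - u'_1) - t (u_0 - u'_0)] the slopes are
    close as soon as [u'_0] is not small, and slopes in [0, 1] make [u'_0] at
    least half of the length of [u']. *)
Lemma slope_close (R : realType) (t t' r D : R) (u u' : 'rV[R]_2) :
  0 <= t <= 1 -> 0 <= t' <= 1 -> 0 < r ->
  u 0 1 = t * u 0 0 -> u' 0 1 = t' * u' 0 0 ->
  r <= eucl_norm u' -> (forall k, `|(u - u') 0 k| <= D) ->
  `|t - t'| <= 4 * D / r.
Proof.
move=> /andP[t0 t1] /andP[t'0 t'1] r0 ut ut' ru' uD.
have := uD 0; have := uD 1.
rewrite !mxE ut ut' => D1 D0.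
have := eucl_norm2_le _ u'; rewrite ut' normrM (ger0_norm t'0) => u'2.
have u'r : r <= 2 * `|u' 0 0|.
  have := normr_ge0 (u' 0 0); nra.
have H : `|t - t'| * `|u' 0 0| <= 2 * D.
  have -> : `|t - t'| * `|u' 0 0| =
            `|(t * u 0 0 - t' * u' 0 0) - t * (u 0 0 - u' 0 0)|.
    by rewrite -normrM; congr `|_|; ring.
  apply: (le_trans (ler_normB _ _)); rewrite normrM (ger0_norm t0).
  have := normr_ge0 (u 0 0 - u' 0 0); nra.
rewrite ler_pdivlMr //; have := normr_ge0 (t - t'); nra.
Qed.

(** * Separated pairs at a hyperdyadic scale *)

(** By contraposition: merging into one set all the pieces of [S] of a given
    class gives a cover whose diameters [expR (- (eta * K * a ^+ j))] have
    [h]-cost [(eta * K)^-1 * a^-1 ^+ j], with sum at most [delta].  The scales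
    must decrease like [expR (- a ^+ j)]; along dyadic scales the costs would
    be [1 / j], with infinite sum. *)
Lemma exists_separated_pair (R : realType) (n : nat) (h : R -> R)
    (delta K a eta : R) (S : set 'rV[R]_n) (F : nat -> set 'rV[R]_n)
    (w : nat -> R) :
  dimension_function h -> 0 < K -> 1 < a -> 0 < eta ->
  expR (- (eta * K)) < delta ->
  (forall x, 0 < x <= expR (- (eta * K)) -> h x = 1 / ln (1 / x)) ->
  (eta * K)^-1 / (1 - a^-1) <= delta ->
  (forall i, 0 < w i <= expR (- K)) ->
  S `<=` \bigcup_i F i ->
  (delta%:E < hausdorff_delta h delta S)%E ->
  exists (j : nat) (i i' : nat) (x y : 'rV[R]_n),
    [/\ F i x, F i' y, S x & S y] /\
    [/\ w i <= expR (- (K * a ^+ j)), expR (- (K * a ^+ j.+1)) <= w i,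
        w i' <= expR (- (K * a ^+ j)), expR (- (K * a ^+ j.+1)) <= w i'
      & expR (- (eta * K * a ^+ j)) < eucl_norm (x - y)].
Proof.
move=> hdim K0 a1 eta0 rdelta hlog Kdelta wK SF; apply: contraPP => nopair.
apply/negP; rewrite -leNgt.
pose inclass j i := expR (- (K * a ^+ j.+1)) <= w i <= expR (- (K * a ^+ j)).
pose G j := S `&` \bigcup_(i in [set i | inclass j i]) F i.
pose r j := expR (- (eta * K * a ^+ j)).
have aj j : 1 <= a ^+ j by rewrite exprn_ege1 // ltW.
have etaK : 0 < eta * K by rewrite mulr_gt0.
have rK j : r j <= expR (- (eta * K)).
  by rewrite ler_expR lerN2 ler_peMr // ltW.
have hr j : h (r j) = (eta * K)^-1 * (a^-1) ^+ j.
  rewrite hlog ?rK ?expR_gt0 // !div1r lnV ?posrE ?expR_gt0 // expRK opprK.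
  by rewrite invfM exprVn.
apply: (@le_trans _ _ (\sum_(0 <= j <oo) (h (r j))%:E)%E); last first.
  under eq_eseriesr do rewrite hr.
  apply: (le_trans (nneseries_geometric_le _ _ _ _ _)).
  - by rewrite invr_ge0 ltW.
  - by rewrite invr_gt0 invf_lt1; lra.
  - by rewrite lee_fin.
apply: (@hausdorff_delta_le_cover _ _ _ _ _ G) => //.
- move=> x Sx; have [i _ Fx] := SF _ Sx.
  have /andP[wi0 wiK] := wK i.
  have y1 : 1 <= - ln (w i) / K.
    by rewrite ler_pdivlMr // mul1r lerNr -(expRK (- K)) ler_ln ?posrE ?expR_gt0.
  have [j /andP[jl ju]] := exists_geometric_scale _ _ _ a1 y1.
  exists j => //; split=> //; exists i => //=.
  rewrite /inclass -(lnK (x := w i)) ?posrE // !ler_expR lerNl lerNr.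
  move: jl ju; rewrite ler_pdivlMr // ltr_pdivrMr // => jl ju.
  by rewrite [K * _]mulrC (ltW ju) mulrC.
- by move=> j; rewrite expR_ge0 (le_lt_trans (rK j)).
- move=> j x y [Sx [i /andP[iu il] Fx]] [Sy [i' /andP[iu' il'] Fy]].
  rewrite leNgt; apply/negP => far; apply: nopair.
  by exists j, i, i', x, y.
Qed.

(** * The null sets of rich slopes *)

Lemma lebesgue_outer_le_of_diam (R : realType) (A : set R) (r : R) :
  0 <= r -> (forall t t', A t -> A t' -> `|t - t'| <= r) ->
  (lebesgue_outer A <= (2 * r)%:E)%E.
Proof.
move=> r0 Ar; have [->|/set0P[x Ax]] := eqVneq A set0.
  by rewrite outer_measure0 lee_fin mulr_ge0.
have sub : A `<=` `[x - r, x + r].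
  move=> t At; rewrite /= in_itv /=.
  by have := Ar _ _ At Ax; rewrite ler_distlC; lra.
apply: (le_trans (le_outer_measure lebesgue_outer _ _ sub)).
(* Lebesgue measure is by definition the restriction of its outer measure. *)
rewrite -[X in (X <= _)%E]/(lebesgue_measure `[x - r, x + r]%classic).
rewrite lebesgue_measure_itv /=; case: ifPn => _; rewrite lee_fin; lra.
Qed.

Lemma lebesgue_outer_double_bigcup_le (R : realType) (B : nat -> nat -> set R)
    (c W : R) (w : nat -> R) :
  0 <= c -> (forall i, 0 <= w i) -> (\sum_(0 <= i <oo) (w i)%:E <= W%:E)%E ->
  (forall i i', (lebesgue_outer (B i i') <= (c * w i * w i')%:E)%E) ->
  (lebesgue_outer (\bigcup_i \bigcup_i' B i i') <= (c * W * W)%:E)%E.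
Proof.
move=> c0 w0 wW Bw.
have W0 : 0 <= W.
  by rewrite -lee_fin (le_trans _ wW) // nneseries_ge0 // => i _ _; rewrite lee_fin.
have scal (k : R) : 0 <= k -> (\sum_(0 <= i <oo) (k * w i)%:E <= (k * W)%:E)%E.
  move=> k0; under eq_eseriesr do rewrite EFinM.
  rewrite nneseriesZl => [|i _]; last by rewrite lee_fin.
  by rewrite EFinM; apply: lee_wpmul2l; rewrite ?lee_fin.
apply: (le_trans (outer_measure_sigma_subadditive _ _)).
apply: (@le_trans _ _ (\sum_(0 <= i <oo) (c * W * w i)%:E)%E); last first.
  by apply: scal; rewrite mulr_ge0.
apply: lee_nneseries => [i _ _|i _]; first exact: outer_measure_ge0.
apply: (le_trans (outer_measure_sigma_subadditive _ _)).
rewrite mulrAC; apply: le_trans (scal _ _); last by rewrite mulr_ge0.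
by apply: lee_nneseries => [i' _ _|i' _]; [exact: outer_measure_ge0 | exact: Bw].
Qed.

(** The weight [w i] is the cost [diam (F i) `^ s] plus a summable correction:
    a set of diameter zero would otherwise have weight zero and belong to no
    scale. *)
Lemma hausdorff_null_cover (R : realType) (n : nat) (s e : R)
    (E : set 'rV[R]_n) :
  0 < s -> 0 < e -> hausdorff_measure (fun x => x `^ s) E = 0%E ->
  exists (F : nat -> set 'rV[R]_n) (w : nat -> R),
    [/\ E `<=` \bigcup_i F i, forall i, 0 < w i,
        (\sum_(0 <= i <oo) (w i)%:E <= e%:E)%E
      & forall i x y, F i x -> F i y -> eucl_norm (x - y) <= w i `^ s^-1].
Proof.
move=> s0 e0 HE.
have H1 : (hausdorff_delta (fun x : R => x `^ s)%R 1 E < (e / 2)%:E)%E.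
  apply: (@le_lt_trans _ _ 0%E); last by rewrite lte_fin divr_gt0.
  by rewrite -HE; apply: ereal_sup_ubound; exists 1 => //=.
have [_ [F [EF F1] <-] sumF] := ereal_inf_lt H1.
pose d i := fine (diam (F i)).
have d0 i : 0 <= d i by rewrite fine_ge0 // diam_ge0.
have dE i : (d i)%:E = diam (F i).
  by rewrite /d fineK // ge0_fin_numE ?diam_ge0 // (lt_trans (F1 i)) ?ltry.
exists F, (fun i => d i `^ s + e / 2 / (2 ^ i.+1)%:R); split=> //.
- by move=> i; rewrite ltr_wpDl ?powR_ge0 // !divr_gt0 // ltr0n expn_gt0.
- under eq_eseriesr do rewrite EFinD.
  apply: (le_trans (epsilon_trick _ _ _)).
  + by move=> i; rewrite lee_fin powR_ge0.
  + by rewrite divr_ge0 // ltW.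
  + by rewrite [X in (_ <= X%:E)%E](splitr e) EFinD leeD2r // ltW.
- move=> i x y Fx Fy.
  have xy : eucl_norm (x - y) <= d i.
    by rewrite -lee_fin dE; exact: eucl_norm_le_diam.
  apply: (le_trans xy).
  have {1}-> : d i = (d i `^ s) `^ s^-1.
    by rewrite -powRrM divff ?gt_eqF // powRr1.
  apply: ge0_ler_powR; rewrite ?nnegrE ?powR_ge0 ?invr_ge0 ?(ltW s0) //.
    by rewrite addr_ge0 ?powR_ge0 // !divr_ge0 // ltW.
  by rewrite lerDl !divr_ge0 // ltW.
Qed.

(** One parameter [delta] serves both as the mesh of the covers and as the
    threshold for the content, so that countably many values of it exhaust the
    slopes in [0, 1] of a Furstenberg set. *)
Definition rich_slopes (R : realType) (h : R -> R) (E : set 'rV[R]_2)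
    (delta : R) : set R :=
  [set t | 0 <= t <= 1 /\ exists S : set 'rV[R]_2,
    [/\ S `<=` E, (delta%:E < hausdorff_delta h delta S)%E
      & forall x y, S x -> S y -> (x - y) 0 1 = t * (x - y) 0 0]].

Lemma le_term_nneseries (R : realType) (w : nat -> R) (W : R) (i : nat) :
  (forall k, 0 <= w k) -> (\sum_(0 <= k <oo) (w k)%:E <= W%:E)%E -> w i <= W.
Proof.
move=> w0 wW; rewrite -lee_fin; apply: le_trans wW.
apply: le_trans (nneseries_lim_ge i.+1 _); last by move=> k _ _; rewrite lee_fin.
by rewrite big_nat_recr //= leeDr // sume_ge0 // => k _; rewrite lee_fin.
Qed.

(** The three conditions say that the largest merged diameter
    [expR (- (eta * K))] is admissible and lies where [h] is logarithmic, and
    that the geometric series of costs, with [q = 1 - a^-1], is small. *)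
Lemma exists_large_scale (R : realType) (eta delta x0 q : R) :
  0 < eta -> 0 < delta -> 0 < x0 -> 0 < q ->
  exists2 K : R, 0 < K & [/\ expR (- (eta * K)) < delta,
    expR (- (eta * K)) < x0 & (eta * K)^-1 / q <= delta].
Proof.
move=> eta0 delta0 x00 q0.
(* [expR (- z) < y] holds once [y^-1 <= z], by [1 + z <= expR z]. *)
pose z := delta^-1 + x0^-1 + (delta * q)^-1.
have d0 : 0 < delta^-1 by rewrite invr_gt0.
have x0' : 0 < x0^-1 by rewrite invr_gt0.
have dq0 : 0 < (delta * q)^-1 by rewrite invr_gt0 mulr_gt0.
have zE : eta * (z / eta) = z by rewrite mulrCA divff ?mulr1 // gt_eqF.
have z0 : 0 < z by rewrite /z; lra.
have ez y : 0 < y -> y^-1 <= z -> expR (- z) < y.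
  move=> y0 yz; rewrite expRN -[y]invrK ltf_pV2 ?posrE ?expR_gt0 ?invr_gt0 //.
  by have := expR_ge1Dx z; lra.
exists (z / eta); first by rewrite divr_gt0.
rewrite zE; split; [apply: ez => //; rewrite /z; lra..|].
rewrite ler_pdivrMr // -[delta * q]invrK lef_pV2 ?posrE // /z; lra.
Qed.

(** Each rich slope comes from a pair of separated points in two sets of one
    class, and the slopes coming from a fixed pair [(i, i')] of sets have
    diameter at most [8 * w i * w i'], so outer measure at most
    [16 * w i * w i'].  Total weight at most [Num.min 1 (e / 16)] makes the sum
    over all pairs at most [e]. *)
Lemma lebesgue_outer_rich_slopes_eq0 (R : realType) (h : R -> R)
    (E : set 'rV[R]_2) (s delta : R) :
  dimension_function h -> (\forall x \near 0^'+, h x = 1 / ln (1 / x)) ->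
  0 < s < 1 / 2 -> hausdorff_measure (fun x => x `^ s) E = 0%E -> 0 < delta ->
  (lebesgue_outer (rich_slopes _ h E delta) = 0)%E.
Proof.
move=> hdim hlog /andP[s0 s12] HE delta0.
have [x0 /= x00 hx0] : exists2 x0, 0 < x0 &
    forall x, 0 < x < x0 -> h x = 1 / ln (1 / x).
  case: hlog => x0 /= x00 hx.
  exists x0 => // x /andP[x0x xx0]; apply: hx => //=.
  by rewrite sub0r normrN gtr0_norm.
apply/eqP; rewrite eq_le outer_measure_ge0 andbT.
apply/lee_addgt0Pr => e e0; rewrite add0e.
have sigma2 : 2 < s^-1 by rewrite -[2]invrK ltf_pV2 ?posrE ?invr_gt0; lra.
(* Any [a] strictly between [1] and [s^-1 / 2] works; this is the midpoint. *)
pose a := (s^-1 + 2) / 4; pose eta := s^-1 - 2 * a.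
have a1 : 1 < a by rewrite /a; lra.
have eta0 : 0 < eta by rewrite /eta /a; lra.
have q0 : 0 < 1 - a^-1 by rewrite subr_gt0 invf_lt1; lra.
have [K K0 [Kdelta Kx0 Kq]] := exists_large_scale _ _ _ _ _ eta0 delta0 x00 q0.
pose e1 := Num.min (expR (- K)) (e / 16).
have e10 : 0 < e1 by rewrite lt_min expR_gt0 divr_gt0.
have [F [w [EF w0 sumw Fw]]] := hausdorff_null_cover _ _ _ _ _ s0 e10 HE.
have we1 i : w i <= e1 by apply: le_term_nneseries sumw => k; exact: ltW.
have wK i : 0 < w i <= expR (- K).
  by rewrite w0 (le_trans (we1 i)) // ge_min lexx.
pose B i i' := [set t : R | 0 <= t <= 1 /\ exists (j : nat) (x y : 'rV[R]_2),
  [/\ F i x, F i' y & (x - y) 0 1 = t * (x - y) 0 0] /\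
  [/\ w i <= expR (- (K * a ^+ j)), expR (- (K * a ^+ j.+1)) <= w i,
      w i' <= expR (- (K * a ^+ j)), expR (- (K * a ^+ j.+1)) <= w i'
    & expR (- (eta * K * a ^+ j)) < eucl_norm (x - y)]].
have Bw i i' : (lebesgue_outer (B i i') <= (16 * w i * w i')%:E)%E.
  rewrite (_ : 16 * w i * w i' = 2 * (8 * (w i * w i'))); last by ring.
  apply: lebesgue_outer_le_of_diam; first by rewrite !mulr_ge0 // ltW.
  move=> t t' [t01 [_ [x [y [[Fx Fy xyt] _]]]]].
  move=> [t'01 [j [x' [y' [[Fx' Fy' xyt'] [wj wj1 wj' wj1' far]]]]]].
  have wsig k : w k <= expR (- (K * a ^+ j)) ->
      w k `^ s^-1 <= expR (- (K * a ^+ j * s^-1)).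
    move=> wk; rewrite -mulNr expRM ge0_ler_powR ?nnegrE ?invr_ge0 ?expR_ge0 //.
      exact: ltW.
    exact: ltW.
  have D k : `|((x - y) - (x' - y')) 0 k| <= 2 * expR (- (K * a ^+ j * s^-1)).
    rewrite (_ : _ - _ = (x - x') - (y - y')); last by rewrite !opprD addrACA.
    rewrite mxE [X in _ + X]mxE (le_trans (ler_normB _ _)) // mulr2n mulrDl.
    rewrite mul1r lerD //.
    + rewrite (le_trans (ler_abs_eucl_norm _ _ _ _)) //.
      by rewrite (le_trans (Fw _ _ _ Fx Fx')) // wsig.
    + rewrite (le_trans (ler_abs_eucl_norm _ _ _ _)) //.
      by rewrite (le_trans (Fw _ _ _ Fy Fy')) // wsig.
  have := slope_close _ _ _ _ _ _ _ t01 t'01 (expR_gt0 _) xyt xyt' (ltW far) D.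
  move/le_trans; apply.
  rewrite mulrA -mulrA -expRN -expRD (_ : 4 * 2 = 8); last by ring.
  rewrite ler_pM2l //.
  (* [eta * K * a ^+ j - K * a ^+ j * s^-1 = - 2 * (K * a ^+ j.+1)] is the
     reason for the choice of [eta]. *)
  rewrite (_ : _ + _ = - (K * a ^+ j.+1) + - (K * a ^+ j.+1)); last first.
    by rewrite exprS /eta; ring.
  by rewrite expRD ler_pM ?expR_ge0.
apply: (@le_trans _ _ (lebesgue_outer (\bigcup_i \bigcup_i' B i i'))).
  apply: le_outer_measure => t [t01 [S [SE Sbig St]]].
  have [|j [i [i' [x [y [[Fx Fy Sx Sy] cls]]]]]] :=
    exists_separated_pair _ _ _ _ _ _ _ _ _ _ hdim K0 a1 eta0
      Kdelta _ Kq wK (subset_trans SE EF) Sbig.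
    by move=> x /andP[x0x xK]; rewrite hx0 // x0x (le_lt_trans xK).
  exists i => //; exists i' => //; split=> //; exists j, x, y.
  by split=> //; split=> //; exact: St.
apply: (le_trans (lebesgue_outer_double_bigcup_le _ _ _ _ _ _ _ sumw Bw)) => //.
  by move=> i; exact: ltW.
rewrite lee_fin.
have e11 : e1 <= 1 by rewrite ge_min -expR0 ler_expR oppr_le0 ltW.
have e1e : e1 <= e / 16 by rewrite ge_min lexx orbT.
nra.
Qed.

(** * Furstenberg sets *)

Lemma rich_slopes_of_furstenberg (R : realType) (h : R -> R) (E : set 'rV[R]_2)
    (t : R) :
  furstenberg_set h E -> 0 <= t <= 1 ->
  exists m : nat, rich_slopes _ h E (m.+1%:R^-1) t.
Proof.
move=> EF t01.
have c0 : 0 < 1 + t ^+ 2 by rewrite ltr_pwDl // sqr_ge0.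
pose e : 'rV[R]_2 :=
  (Num.sqrt (1 + t ^+ 2))^-1 *: \row_i (if i == 0 then 1 else t).
have eE : unit_circle e.
  rewrite /unit_circle /= eucl_norm2E !mxE /= mulr1.
  rewrite exprMn -[X in X + _]mulr1 -mulrDr exprVn sqr_sqrtr ?(ltW c0) //.
  by rewrite mulVf ?gt_eqF // sqrtr1.
have [a [L [_ /ereal_sup_gt[_ [d /= d0 <-] Hd]]]] := EF _ eE.
set S := segment a e L `&` E in Hd.
have [r r0 rH] : exists2 r : R, 0 < r & (r%:E <= hausdorff_delta h d S)%E.
  move: Hd; case: (hausdorff_delta h d S) => [r||] //; first by exists r.
  by exists 1; rewrite ?leey.
have rd0 : 0 < Num.min r d by rewrite lt_min r0.
have [m _ /(_ m (leqnn m)) /=] := near_infty_natSinv_lt (PosNum rd0).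
rewrite lt_min => /andP[mr md]; exists m; split=> //; exists S; split=> //.
- by move=> x [].
- apply: (@lt_le_trans _ _ r%:E); first by rewrite lte_fin.
  by apply: (le_trans rH); apply: hausdorff_delta_anti; exact: ltW.
- by move=> _ _ [[u _ <-] _] [[v _ <-] _]; rewrite !mxE /=; ring.
Qed.

Theorem theorem5p1 (R : realType) (h : R -> R)
  (h_dim : dimension_function h)
  (h_log : \forall x \near 0^'+, h x = 1 / ln (1 / x))
  (E : set 'rV[R]_2) (E_furst : furstenberg_set h E) :
  ((1 / 2 : R)%:E <= hausdorff_dim E)%E.
Proof.
apply: le_ereal_inf_tmp => _ [s [s0 HE] <-].
rewrite lee_fin leNgt; apply/negP => s12.
have sub : `[0, 1] `<=` \bigcup_m rich_slopes _ h E (m.+1%:R^-1).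
  move=> t; rewrite /= in_itv /= => t01.
  by have [m tm] := rich_slopes_of_furstenberg _ _ _ _ E_furst t01; exists m.
have := le_trans (le_outer_measure lebesgue_outer _ _ sub)
                 (outer_measure_sigma_subadditive _ _).
rewrite eseries0 => [|m _ _]; last first.
  by apply: (@lebesgue_outer_rich_slopes_eq0 _ _ _ s); rewrite ?s0 // invr_gt0.
rewrite -[X in (X <= _)%E]/(lebesgue_measure `[0, 1]%classic).
by rewrite lebesgue_measure_itv /= lte_fin ltr01 oppr0 adde0 lee_fin ler10.
Qed.
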